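(* Let $(M,h)$ be a closed Riemannian spin manifold, let $\kappa\in\mathbb{R}$, and let $(\phi,\psi)$ be a smooth $\kappa$-Dirac-harmonic map from $M$ to the round sphere $S^n\subset\mathbb{R}^{n+1}$. Then for all $i,m\in\{1,\dots,n+1\}$ the vector field on $M$ with components $$J_\alpha^{im}:=\operatorname{Re}\langle e_\alpha\cdot\psi^i,\psi^m\rangle_{\Sigma M}+(\phi^i_\alpha\phi^m-\phi^i\phi^m_\alpha)$$ is divergence free.
   Context: $\Sigma M$ is the spinor bundle of $(M,h)$ with hermitian scalar product $\langle\cdot,\cdot\rangle_{\Sigma M}$ (taken conjugate-linear in the first and linear in the second slot) and metric spin connection $\nabla^{\Sigma M}$. Clifford multiplication by tangent vectors is skew-symmetric, $\langle\psi,X\cdot\eta\rangle=-\langle X\cdot\psi,\eta\rangle$, and satisfies $X\cdot Y\cdot\psi+Y\cdot X\cdot\psi=-2h(X,Y)\psi$. $(e_\alpha)$ is a local orthonormal frame of $TM$, $\not\partial=e_\alpha\cdot\nabla^{\Sigma M}_{e_\alpha}$ is the Dirac operator on $\Sigma M$, repeated indices are summed, and $\phi^j_\alpha:=d\phi^j(e_\alpha)$. $\Delta$ is the Laplace-Beltrami operator $\operatorname{div}\nabla$ on functions. A map to $S^n$ is written $\phi=(\phi^1,\dots,\phi^{n+1})$ with $|\phi|=1$, and a vector spinor along $\phi$ (a section of $\Sigma M\otimes\phi^\ast TS^n$) is written $\psi=(\psi^1,\dots,\psi^{n+1})$ with each $\psi^i$ a section of $\Sigma M$ and $\sum_i\phi^i\psi^i=0$;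 $|\psi|^2=\sum_i|\psi^i|^2$. A smooth $\kappa$-Dirac-harmonic map from $M$ to $S^n$ is a smooth pair $(\phi,\psi)$ of this kind solving, for $i=1,\dots,n+1$, $$-\Delta\phi^i=|d\phi|^2\phi^i+\operatorname{Re}\langle\psi^i,e_\alpha\cdot\psi^j\rangle_{\Sigma M}\phi^j_\alpha,$$ $$\not\partial\psi^i=-\phi^j_\alpha\,\phi^i\, e_\alpha\cdot\psi^j-2\kappa\big(|\psi|^2\psi^i-\langle\psi^j,\psi^i\rangle_{\Sigma M}\psi^j\big).$$ *)

(* Defs.v *)
From HB Require Import structures.
From mathcomp Require Import all_boot all_order all_algebra.
From mathcomp Require Import all_classical all_reals all_analysis.
From mathcomp Require Import complex.

Set Implicit Arguments.
Unset Strict Implicit.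
Unset Printing Implicit Defensive.

Import Order.TTheory GRing.Theory Num.Theory.
Import numFieldNormedType.Exports.

Local Open Scope classical_set_scope.
Local Open Scope ring_scope.
Local Open Scope complex_scope.

(* C^k by iterated partial derivatives; meant for open U *)
Fixpoint Ck_on (R : realType) (d k : nat) (U : set 'rV[R]_d)
    (f : 'rV[R]_d -> R) : Prop :=
  (forall x, U x -> {for x, continuous f}) /\
  match k with
  | 0 => True
  | k'.+1 => forall i : 'I_d,
      (forall x, U x -> derivable f x (delta_mx 0 i)) /\
      Ck_on k' U (fun x => 'D_(delta_mx 0 i) f x)
  end.

Definition Cinfty_on (R : realType) (d : nat) (U : set 'rV[R]_d)
    (f : 'rV[R]_d -> R) : Prop := forall k, Ck_on k U f.

(* Charts take values in open subsets of R^d, so the manifold has no boundary.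
   [mfd_inv c] is only meaningful on the image of [mfd_dom c]. *)
Record smooth_manifold (R : realType) (d : nat) := SmoothManifold {
  mfd_space :> topologicalType;
  mfd_hausdorff : hausdorff_space mfd_space;
  mfd_second_countable : @second_countable mfd_space;
  mfd_index : Type;
  mfd_dom : mfd_index -> set mfd_space;
  mfd_chart : mfd_index -> mfd_space -> 'rV[R]_d;
  mfd_inv : mfd_index -> 'rV[R]_d -> mfd_space;
  mfd_dom_open : forall c, open (mfd_dom c);
  mfd_img_open : forall c, open (mfd_chart c @` mfd_dom c);
  mfd_cover : forall p, exists c, mfd_dom c p;
  mfd_chartK : forall c p, mfd_dom c p -> mfd_inv c (mfd_chart c p) = p;
  mfd_chart_continuous : forall c p, mfd_dom c p ->
    {for p, continuous (mfd_chart c)};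
  mfd_inv_continuous : forall c x, (mfd_chart c @` mfd_dom c) x ->
    {for x, continuous (mfd_inv c)};
  mfd_transition : forall c c' (i : 'I_d),
    Cinfty_on (mfd_chart c @` (mfd_dom c `&` mfd_dom c'))
      (fun x => mfd_chart c' (mfd_inv c x) 0 i)
}.

(* Meant for open U; the values of f outside U are irrelevant *)
Definition smooth_on (R : realType) (d : nat) (M : smooth_manifold R d)
    (U : set M) (f : M -> R) : Prop :=
  forall c : mfd_index M,
    Cinfty_on (mfd_chart c @` (mfd_dom c `&` U)) (fun x => f (mfd_inv c x)).

Definition smooth_near (R : realType) (d : nat) (M : smooth_manifold R d)
    (p : M) (f : M -> R) : Prop :=
  exists U : set M, [/\ open U, U p & smooth_on U f].

Definition functional (R : realType) (d : nat) (M : smooth_manifold R d) : Type :=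
  (M -> R) -> R.

(* T_p M as derivations at p of germs of smooth functions.  The last clause
   fixes the value on the irrelevant functions, so that two tangent vectors
   acting equally on smooth germs are equal. *)
Definition is_tangent (R : realType) (d : nat) (M : smooth_manifold R d)
    (p : M) (v : functional M) : Prop :=
  [/\ forall (c : R) (f g : M -> R), smooth_near p f -> smooth_near p g ->
        v (fun q => c * f q + g q) = c * v f + v g,
      forall f g : M -> R, smooth_near p f -> smooth_near p g ->
        v (fun q => f q * g q) = v f * g p + f p * v g,
      forall f g : M -> R, (\forall q \near p, f q = g q) -> v f = v g &
      forall f : M -> R, ~ smooth_near p f -> v f = 0].

Definition vector_field (R : realType) (d : nat) (M : smooth_manifold R d) : Type :=
  M -> functional M.

Definition smooth_vf (R : realType) (d : nat) (M : smooth_manifold R d)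
    (U : set M) (X : vector_field M) : Prop :=
  (forall p, U p -> is_tangent p (X p)) /\
  (forall (V : set M) (f : M -> R), open V -> V `<=` U -> smooth_on V f ->
     smooth_on V (fun q => X q f)).

(* The laws of a metric or a connection only concern tangent vectors and
   smooth (local) vector fields; other values are irrelevant. *)
Record riemannian_metric (R : realType) (d : nat) (M : smooth_manifold R d) :=
  RiemannianMetric {
  metric :> M -> functional M -> functional M -> R;
  metric_sym : forall p u v, is_tangent p u -> is_tangent p v ->
    metric p u v = metric p v u;
  metric_linear : forall p (c : R) u v w,
    is_tangent p u -> is_tangent p v -> is_tangent p w ->
    metric p (fun f => c * u f + v f) w = c * metric p u w + metric p v w;
  metric_pos : forall p v, is_tangent p v -> (exists f, v f != 0) ->
    0 < metric p v v;
  metric_smooth : forall U X Y, open U -> smooth_vf U X -> smooth_vf U Y ->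
    smooth_on U (fun q => metric q (X q) (Y q))
}.

(* [nabla p v Y] is the covariant derivative at p of the vector field Y,
   defined near p, in direction v *)
Record levi_civita (R : realType) (d : nat) (M : smooth_manifold R d)
    (h : riemannian_metric M) := LeviCivita {
  nabla :> M -> functional M -> vector_field M -> functional M;
  nabla_smooth : forall U X Y, open U -> smooth_vf U X -> smooth_vf U Y ->
    smooth_vf U (fun q => nabla q (X q) Y);
  nabla_tangent : forall U Y p v, open U -> U p -> smooth_vf U Y ->
    is_tangent p v -> is_tangent p (nabla p v Y);
  nabla_local : forall U Y Z p v, open U -> U p -> smooth_vf U Y ->
    smooth_vf U Z -> is_tangent p v -> (forall q, U q -> Y q = Z q) ->
    nabla p v Y = nabla p v Z;
  nabla_linear : forall U Y p (c : R) u v, open U -> U p -> smooth_vf U Y ->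
    is_tangent p u -> is_tangent p v ->
    nabla p (fun f => c * u f + v f) Y =
      (fun f => c * nabla p u Y f + nabla p v Y f);
  nabla_add : forall U Y Z p v, open U -> U p -> smooth_vf U Y ->
    smooth_vf U Z -> is_tangent p v ->
    nabla p v (fun q f => Y q f + Z q f) =
      (fun f => nabla p v Y f + nabla p v Z f);
  nabla_leibniz : forall U Y g p v, open U -> U p -> smooth_vf U Y ->
    smooth_on U g -> is_tangent p v ->
    nabla p v (fun q f => g q * Y q f) =
      (fun f => v g * Y p f + g p * nabla p v Y f);
  nabla_metric : forall U Y Z p v, open U -> U p -> smooth_vf U Y ->
    smooth_vf U Z -> is_tangent p v ->
    v (fun q => h q (Y q) (Z q)) =
      h p (nabla p v Y) (Z p) + h p (Y p) (nabla p v Z);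
  nabla_torsion : forall U X Y p f, open U -> U p -> smooth_vf U X ->
    smooth_vf U Y -> smooth_near p f ->
    nabla p (X p) Y f - nabla p (Y p) X f =
      X p (fun q => Y q f) - Y p (fun q => X q f)
}.

Definition orthonormal_frame (R : realType) (d : nat) (M : smooth_manifold R d)
    (h : riemannian_metric M) (U : set M) (e : 'I_d -> vector_field M) : Prop :=
  [/\ forall al, smooth_vf U (e al),
      forall p al be, U p -> h p (e al p) (e be p) = (al == be)%:R &
      forall p v, U p -> is_tangent p v ->
        exists c : 'I_d -> R, v = (fun f => \sum_al c al * e al p f)].

(* The trace of v |-> nabla_v X, in the orthonormal frame e *)
Definition divergence (R : realType) (d : nat) (M : smooth_manifold R d)
    (h : riemannian_metric M) (D : levi_civita h) (e : 'I_d -> vector_field M)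
    (X : vector_field M) (p : M) : R :=
  \sum_al h p (D p (e al p) X) (e al p).

Definition gradient (R : realType) (d : nat) (M : smooth_manifold R d)
    (e : 'I_d -> vector_field M) (f : M -> R) : vector_field M :=
  fun p g => \sum_al e al p f * e al p g.

Definition laplacian (R : realType) (d : nat) (M : smooth_manifold R d)
    (h : riemannian_metric M) (D : levi_civita h) (e : 'I_d -> vector_field M)
    (f : M -> R) (p : M) : R :=
  divergence D e (gradient e f) p.

Definition adjmx (R : realType) (m n : nat) (A : 'M[R[i]]_(m, n)) : 'M[R[i]]_(n, m) :=
  (map_mx (@conjc R) A)^T.

(* Complex dimension of the spinor module of Cl(R^d) *)
Definition spin_dim (d : nat) : nat := (2 ^ d./2)%N.

(* A representation of Cl(R^d) of this dimension is irreducible.  It is unique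
   up to unitary equivalence for d even; for d odd there are two, which restrict
   to the same representation of Spin(d), and either one may be used. *)
Record clifford_rep (R : realType) (d : nat) := CliffordRep {
  gamma :> 'I_d -> 'M[R[i]]_(spin_dim d);
  gamma_clifford : forall al be,
    gamma al *m gamma be + gamma be *m gamma al = (- (2 * (al == be)%:R))%:M;
  gamma_skew : forall al, adjmx (gamma al) = - gamma al
}.

Definition gamma_vec (R : realType) (d : nat) (g : clifford_rep R d)
    (x : 'rV[R]_d) : 'M[R[i]]_(spin_dim d) :=
  \sum_al (x 0 al)%:C *: g al.

(* Spin(d), the products of an even number of unit vectors of Cl(R^d).  The
   even part of the Clifford algebra acts faithfully on spinors, so Spin(d) is
   identified with its image in the matrices. *)
Definition spin_group (R : realType) (d : nat) (g : clifford_rep R d) :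
    set 'M[R[i]]_(spin_dim d) :=
  [set A | exists s : seq 'rV[R]_d,
     [/\ ~~ odd (size s),
         forall x, x \in s -> \sum_al x 0 al ^+ 2 = 1 &
         A = foldr (fun x B => gamma_vec g x *m B) 1%:M s]].

Definition smooth_onC (R : realType) (d : nat) (M : smooth_manifold R d)
    (U : set M) (f : M -> R[i]) : Prop :=
  smooth_on U (fun q => complex.Re (f q)) /\ smooth_on U (fun q => complex.Im (f q)).

(* A spin structure given by local sections of the Spin(d)-bundle: an open
   cover, a local orthonormal frame on each member, and a Spin(d)-valued cocycle
   lifting the SO(d)-valued transition functions of these frames.  Consistency
   of the orientations is implied by the existence of the lifts. *)
Record spin_structure (R : realType) (d : nat) (M : smooth_manifold R d)
    (h : riemannian_metric M) (g : clifford_rep R d) := SpinStructure {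
  spin_index : Type;
  spin_dom : spin_index -> set M;
  spin_frame : spin_index -> 'I_d -> vector_field M;
  spin_trans : spin_index -> spin_index -> M -> 'M[R[i]]_(spin_dim d);
  spin_dom_open : forall a, open (spin_dom a);
  spin_cover : forall p, exists a, spin_dom a p;
  spin_frame_orthonormal : forall a,
    orthonormal_frame h (spin_dom a) (spin_frame a);
  spin_trans_spin : forall a b p, spin_dom a p -> spin_dom b p ->
    spin_group g (spin_trans a b p);
  spin_trans_smooth : forall a b k l,
    smooth_onC (spin_dom a `&` spin_dom b) (fun q => spin_trans a b q k l);
  spin_cocycle : forall a b c p,
    spin_dom a p -> spin_dom b p -> spin_dom c p ->
    spin_trans a b p *m spin_trans b c p = spin_trans a c p;
  spin_lift : forall a b p be, spin_dom a p -> spin_dom b p ->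
    spin_trans a b p *m g be =
      (\sum_al (h p (spin_frame b be p) (spin_frame a al p))%:C *: g al)
        *m spin_trans a b p
}.

(* A smooth section of the spinor bundle: its components in the local
   trivializations induced by the spin structure.  In trivialization a,
   Clifford multiplication by the frame vector e_al is the matrix g al, and the
   hermitian product is the standard one (preserved by Spin(d)). *)
Record spinor_field (R : realType) (d : nat) (M : smooth_manifold R d)
    (h : riemannian_metric M) (g : clifford_rep R d) (S : spin_structure h g) :=
  SpinorField {
  spinor_comp :> spin_index S -> M -> 'cV[R[i]]_(spin_dim d);
  spinor_smooth : forall a k,
    smooth_onC (spin_dom a) (fun q => spinor_comp a q k 0);
  spinor_glue : forall a b p, spin_dom a p -> spin_dom b p ->
    spinor_comp a p = spin_trans a b p *m spinor_comp b p
}.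

(* Conjugate-linear in the first slot *)
Definition herm (R : realType) (N : nat) (u v : 'cV[R[i]]_N) : R[i] :=
  \sum_k conjc (u k 0) * v k 0.

Definition sqnorm (R : realType) (N : nat) (u : 'cV[R[i]]_N) : R :=
  complex.Re (herm u u).

Definition dirderC (R : realType) (d : nat) (M : smooth_manifold R d) (N : nat)
    (v : functional M) (F : M -> 'cV[R[i]]_N) : 'cV[R[i]]_N :=
  \col_k (v (fun q => complex.Re (F q k 0)) +i* v (fun q => complex.Im (F q k 0))).

(* nabla_v psi = v(psi) + 1/4 sum_{b,c} h(nabla_v e_b, e_c) e_b . e_c . psi *)
Definition spin_connection (R : realType) (d : nat) (M : smooth_manifold R d)
    (h : riemannian_metric M) (D : levi_civita h) (g : clifford_rep R d)
    (S : spin_structure h g) (psi : spinor_field S) (a : spin_index S)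
    (p : M) (v : functional M) : 'cV[R[i]]_(spin_dim d) :=
  dirderC v (psi a) +
  4^-1 *: \sum_be \sum_ga
    (h p (D p v (spin_frame a be)) (spin_frame a ga p))%:C *:
      (g be *m (g ga *m psi a p)).

Definition dirac (R : realType) (d : nat) (M : smooth_manifold R d)
    (h : riemannian_metric M) (D : levi_civita h) (g : clifford_rep R d)
    (S : spin_structure h g) (psi : spinor_field S) (a : spin_index S)
    (p : M) : 'cV[R[i]]_(spin_dim d) :=
  \sum_al g al *m spin_connection D psi a p (spin_frame a al p).

(* phi^j_alpha at p, in the frame with index a *)
Definition dphi (R : realType) (d : nat) (M : smooth_manifold R d)
    (h : riemannian_metric M) (g : clifford_rep R d) (S : spin_structure h g)
    (n : nat) (phi : 'I_n.+1 -> M -> R) (a : spin_index S) (p : M)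
    (j : 'I_n.+1) (al : 'I_d) : R :=
  spin_frame a al p (phi j).

Record dirac_harmonic (R : realType) (d n : nat) (M : smooth_manifold R d)
    (h : riemannian_metric M) (D : levi_civita h) (g : clifford_rep R d)
    (S : spin_structure h g) (kappa : R) (phi : 'I_n.+1 -> M -> R)
    (psi : 'I_n.+1 -> spinor_field S) : Prop := DiracHarmonic {
  dh_smooth : forall i, smooth_on setT (phi i);
  dh_sphere : forall p, \sum_i phi i p ^+ 2 = 1;
  dh_tangent : forall a p, spin_dom a p ->
    \sum_i (phi i p)%:C *: psi i a p = 0;
  dh_map_eq : forall a p i, spin_dom a p ->
    - laplacian D (spin_frame a) (phi i) p =
      (\sum_j \sum_al dphi phi a p j al ^+ 2) * phi i p +
      \sum_al \sum_j
        complex.Re (herm (psi i a p) (g al *m psi j a p)) * dphi phi a p j al;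
  dh_spinor_eq : forall a p i, spin_dom a p ->
    dirac D (psi i) a p =
      - (\sum_al \sum_j
           (dphi phi a p j al * phi i p)%:C *: (g al *m psi j a p))
      - (2 * kappa)%:C *:
          ((\sum_j sqnorm (psi j a p))%:C *: psi i a p -
           \sum_j herm (psi j a p) (psi i a p) *: psi j a p)
}.

Definition current_comp (R : realType) (d n : nat) (M : smooth_manifold R d)
    (h : riemannian_metric M) (g : clifford_rep R d) (S : spin_structure h g)
    (phi : 'I_n.+1 -> M -> R) (psi : 'I_n.+1 -> spinor_field S)
    (i m : 'I_n.+1) (a : spin_index S) (p : M) (al : 'I_d) : R :=
  complex.Re (herm (g al *m psi i a p) (psi m a p)) +
  (dphi phi a p i al * phi m p - phi i p * dphi phi a p m al).

(* Main.v *)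
(* In a spin frame, set G(al,be,ga) = h(nabla_{e_al} e_be, e_ga), antisymmetric
   in be, ga.  The divergence of c_al e_al is
   sum e_al(c_al) + sum G(al,be,al) c_be.  For c_al = Re<e_al.psi^i, psi^m> this
   is Re<dirac psi^i, psi^m> - Re<psi^i, dirac psi^m>: the zeroth-order part
   A = 1/4 sum G(al,be,ga) e_al.e_be.e_ga of the Dirac operator satisfies
   A - A^* = sum G(al,be,al) e_be by the Clifford relations.  The quartic terms
   of the spinor equation give a hermitian form, so they cancel, and what is
   left cancels with phi^m Delta phi^i - phi^i Delta phi^m.  The local
   expressions of J glue because Spin(d) acts unitarily on spinors and its
   transition functions lift those of the frames. *)
Require Import Defs.
From HB Require Import structures.
From mathcomp Require Import all_boot all_order all_algebra.
From mathcomp Require Import all_classical all_reals all_analysis.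
From mathcomp Require Import complex ring.

Set Implicit Arguments.
Unset Strict Implicit.
Unset Printing Implicit Defensive.

Import Order.TTheory GRing.Theory Num.Theory.
Import numFieldNormedType.Exports.

Local Open Scope classical_set_scope.
Local Open Scope ring_scope.

(** * Calculus of C^k functions on open subsets of R^d *)

Section CkOn.
Context {R : realType} {d : nat}.
Implicit Types (U W : set 'rV[R]_d) (f g : 'rV[R]_d -> R).

Lemma Ck_on_sub k U W f : W `<=` U -> Ck_on k U f -> Ck_on k W f.
Proof.
move=> WU; elim: k f => [|k IH] f /= [cf df]; split=> //.
- by move=> x /WU; exact: cf.
- by move=> x /WU; exact: cf.
- move=> i; have [dif Df] := df i; split; last exact: IH.
  by move=> x /WU; exact: dif.
Qed.

(** Each clause of [Ck_on] is a condition at single points on limits in the ambient space, so it can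
    be checked at [x] in any piece [W] containing [x]. *)
Lemma Ck_on_local k U f :
  (forall x, U x -> exists2 W, W x & Ck_on k W f) -> Ck_on k U f.
Proof.
elim: k f => [|k IH] f H /=; split=> //.
- by move=> x /H[W Wx [cf _]]; exact: cf.
- by move=> x /H[W Wx [cf _]]; exact: cf.
- move=> i; split=> [x /H[W Wx [_ /(_ i)[dif _]]]|]; first exact: dif.
  by apply: IH => x /H[W Wx [_ /(_ i)[_ Df]]]; exists W.
Qed.

Lemma Ck_onW k U f : Ck_on k.+1 U f -> Ck_on k U f.
Proof.
elim: k f => [|k IH] f /= [cf df]; split=> // i.
by have [dif Df] := df i; split=> //; exact: IH.
Qed.

(** Continuity and partial derivatives look at a whole neighbourhood; since [U] is open, [f] and [g]
    agree near each of its points, and so do their derivatives, which feeds the induction. *)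
Lemma Ck_on_eq k U f g : open U -> (forall x, U x -> f x = g x) ->
  Ck_on k U f -> Ck_on k U g.
Proof.
move=> oU; have nfg f' g' : (forall x, U x -> f' x = g' x) ->
    forall x, U x -> {near x, f' =1 g'}.
  by move=> fg x Ux; apply: filterS (open_nbhs_nbhs (conj oU Ux)) => y /fg.
have ctg f' g' : (forall x, U x -> f' x = g' x) ->
    (forall x, U x -> {for x, continuous f'}) ->
    forall x, U x -> {for x, continuous g'}.
  move=> fg cf x Ux; move: (cf x Ux).
  rewrite /prop_for /continuous_at (fg _ Ux).
  by apply: cvg_trans; exact: (near_eq_cvg (F := nbhs x)) (nfg _ _ fg _ Ux).
elim: k f g => [|k IH] f g fg /= [cf df]; split=> //; try exact: ctg fg cf.
move=> i; have [dif Df] := df i; split.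
  move=> x Ux; apply: near_eq_derivable (dif _ Ux); exact: nfg fg _ Ux.
by apply: IH Df => x Ux; apply: near_eq_derive; exact: nfg fg _ Ux.
Qed.

Lemma Ck_on_cst k U (r : R) : Ck_on k U (fun=> r).
Proof.
elim: k r => [|k IH] r /=; split=> //; try by move=> x _; exact: cst_continuous.
move=> i; split=> [x _|]; first exact: derivable_cst.
suff -> : (fun x : 'rV[R]_d => 'D_(delta_mx 0 i) (fun=> r) x) = (fun=> 0) by [].
by apply/funext => x; exact: derive_cst.
Qed.

Lemma Ck_onD k U f g : open U -> Ck_on k U f -> Ck_on k U g ->
  Ck_on k U (fun x => f x + g x).
Proof.
move=> oU; elim: k f g => [|k IH] f g [cf df] [cg dg]; split=> //.
- by move=> x Ux; exact: continuousD (cf _ Ux) (cg _ Ux).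
- by move=> x Ux; exact: continuousD (cf _ Ux) (cg _ Ux).
move=> i; have [dif Df] := df i; have [dig Dg] := dg i; split.
  by move=> x Ux; exact: derivableD (dif _ Ux) (dig _ Ux).
apply: Ck_on_eq (IH _ _ Df Dg) => // x Ux.
by rewrite -deriveD; [|exact: dif|exact: dig].
Qed.

Lemma Ck_onM k U f g : open U -> Ck_on k U f -> Ck_on k U g ->
  Ck_on k U (fun x => f x * g x).
Proof.
move=> oU; elim: k f g => [|k IH] f g Cf Cg.
  by case: Cf Cg => [cf _] [cg _]; split=> // x Ux;
    exact: continuousM (cf _ Ux) (cg _ Ux).
(* The Leibniz rule pairs a derivative, known to order [k], with an undifferentiated factor, which
   therefore has to be lowered from order [k.+1] to [k]. *)
have Cf' := Ck_onW Cf; have Cg' := Ck_onW Cg.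
case: Cf Cg => [cf df] [cg dg]; split.
  by move=> x Ux; exact: continuousM (cf _ Ux) (cg _ Ux).
move=> i; have [dif Df] := df i; have [dig Dg] := dg i; split.
  by move=> x Ux; exact: derivableM (dif _ Ux) (dig _ Ux).
apply: Ck_on_eq (Ck_onD oU (IH _ _ Cf' Dg) (IH _ _ Cg' Df)) => // x Ux.
by rewrite -[RHS]/('D__ (f * g) x) deriveM; [|exact: dif|exact: dig].
Qed.

End CkOn.

(** * Smooth functions on the manifold, read off in charts *)

Section SmoothOn.
Context {R : realType} {d : nat} {M : smooth_manifold R d}.
Implicit Types (U V : set M) (f g : M -> R).

(** Near an image point, the set contains the intersection of the open chart image with the preimage
    of [U] under [mfd_inv], which is continuous there. *)
Lemma chart_image_open (c : mfd_index M) U : open U ->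
  open (mfd_chart c @` (mfd_dom c `&` U)).
Proof.
move=> oU; rewrite openE => _ [p [cp Up] <-].
have im : (mfd_chart c @` mfd_dom c) (mfd_chart c p) by exists p.
have nI : nbhs (mfd_chart c p) (mfd_chart c @` mfd_dom c).
  by apply: open_nbhs_nbhs; split=> //; exact: mfd_img_open.
have nU : nbhs (mfd_chart c p) (mfd_inv c @^-1` U).
  apply: (mfd_inv_continuous im); rewrite (mfd_chartK cp).
  exact: open_nbhs_nbhs.
rewrite /interior; near=> x.
have [q cq qx] : (mfd_chart c @` mfd_dom c) x by near: x.
have : U (mfd_inv c x) by near: x.
by rewrite -qx mfd_chartK // => Uq; exists q.
Unshelve. all: by end_near. Qed.

Lemma smooth_on_sub U V f : V `<=` U -> smooth_on U f -> smooth_on V f.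
Proof.
move=> VU sf c k; apply: Ck_on_sub (sf c k) => _ [p [cp Vp] <-].
by exists p => //; split=> //; exact: VU.
Qed.

Lemma smooth_on_local U f :
  (forall p, U p -> exists2 V, V p & smooth_on V f) -> smooth_on U f.
Proof.
move=> H c k; apply: Ck_on_local => _ [p [cp /H[V Vp sf]] <-].
by exists (mfd_chart c @` (mfd_dom c `&` V)); [exists p|exact: sf].
Qed.

Lemma smooth_on_eq U f g : open U -> (forall p, U p -> f p = g p) ->
  smooth_on U f -> smooth_on U g.
Proof.
move=> oU fg sf c k; apply: Ck_on_eq (sf c k); first exact: chart_image_open.
by move=> _ [p [cp Up] <-]; rewrite mfd_chartK // fg.
Qed.

Lemma smooth_on_cst U (r : R) : smooth_on U (fun=> r).
Proof. by move=> c k; exact: Ck_on_cst. Qed.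

Lemma smooth_onD U f g : open U -> smooth_on U f -> smooth_on U g ->
  smooth_on U (fun p => f p + g p).
Proof.
by move=> oU sf sg c k; apply: Ck_onD (sf c k) (sg c k); exact: chart_image_open.
Qed.

Lemma smooth_onM U f g : open U -> smooth_on U f -> smooth_on U g ->
  smooth_on U (fun p => f p * g p).
Proof.
by move=> oU sf sg c k; apply: Ck_onM (sf c k) (sg c k); exact: chart_image_open.
Qed.

Lemma smooth_onN U f : open U -> smooth_on U f -> smooth_on U (fun p => - f p).
Proof.
move=> oU sf; apply: smooth_on_eq (smooth_onM oU (smooth_on_cst U (-1)) sf) => //.
by move=> p _; rewrite mulN1r.
Qed.

Lemma smooth_onB U f g : open U -> smooth_on U f -> smooth_on U g ->
  smooth_on U (fun p => f p - g p).
Proof. by move=> oU sf sg; exact: smooth_onD sf (smooth_onN oU sg). Qed.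

Lemma smooth_on_sum (I : Type) (r : seq I) U (F : I -> M -> R) : open U ->
  (forall i, smooth_on U (F i)) -> smooth_on U (fun p => \sum_(i <- r) F i p).
Proof.
move=> oU sF; elim: r => [|i r IH].
  by apply: smooth_on_eq (smooth_on_cst U 0) => // p _; rewrite big_nil.
by apply: smooth_on_eq (smooth_onD oU (sF i) IH) => // p _; rewrite big_cons.
Qed.

Lemma smooth_onW U f p : open U -> U p -> smooth_on U f -> smooth_near p f.
Proof. by exists U. Qed.

End SmoothOn.

(** * Tangent vectors as derivations, and smooth vector fields *)

Section Tangent.
Context {R : realType} {d : nat} {M : smooth_manifold R d}.
Implicit Types (U V : set M) (f g : M -> R) (u v w : functional M).

Lemma is_tangent0 (p : M) : is_tangent p (fun=> 0).
Proof. by split=> *; rewrite ?mulr0 ?mul0r ?addr0. Qed.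

Lemma is_tangent_lin (p : M) (c : R) u v : is_tangent p u -> is_tangent p v ->
  is_tangent p (fun f => c * u f + v f).
Proof.
move=> [u1 u2 u3 u4] [v1 v2 v3 v4]; split.
- by move=> r f g sf sg; rewrite u1 // v1 // !mulrDr mulrCA addrACA.
- move=> f g sf sg; rewrite u2 // v2 // mulrDr mulrDl mulrDr addrACA.
  by rewrite mulrA (mulrCA c).
- by move=> f g fg; rewrite (u3 _ _ fg) (v3 _ _ fg).
- by move=> f sf; rewrite u4 // v4 // mulr0 addr0.
Qed.

Lemma is_tangent_sum (I : Type) (r : seq I) (p : M) (c : I -> R)
    (v : I -> functional M) : (forall i, is_tangent p (v i)) ->
  is_tangent p (fun f => \sum_(i <- r) c i * v i f).
Proof.
move=> tv; elim: r => [|i r IH].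
  by under eq_fun do rewrite big_nil; exact: is_tangent0.
by under eq_fun do rewrite big_cons; exact: is_tangent_lin.
Qed.

Section Derivation.
Variables (U : set M) (p : M) (v : functional M).
Hypotheses (oU : open U) (Up : U p) (tv : is_tangent p v).

(** The Leibniz rule for 1 = 1 * 1 gives v(1) = v(1) + v(1), and linearity for 0 = 1 * 0 + 0 gives
    the same for v(0). Then r = r * 1 + 0. *)
Lemma tangent_cst (r : R) : v (fun=> r) = 0.
Proof.
have [v1 v2 _ _] := tv.
have s r' : smooth_near p (fun=> r' : R).
  by apply: smooth_onW oU Up _; exact: smooth_on_cst.
have v0 : v (fun=> 0) = 0.
  have := v1 1 (fun=> 0) (fun=> 0) (s 0) (s 0).
  under eq_fun do rewrite mulr0 addr0.
  by rewrite mul1r -[X in X = _]addr0 => /addrI.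
have v11 : v (fun=> 1) = 0.
  have := v2 (fun=> 1) (fun=> 1) (s 1) (s 1).
  under eq_fun do rewrite mulr1.
  by rewrite mulr1 mul1r -[X in X = _]addr0 => /addrI.
have := v1 r (fun=> 1) (fun=> 0) (s 1) (s 0).
by under eq_fun do rewrite mulr1 addr0; rewrite v11 v0 mulr0 addr0.
Qed.

Lemma tangent_eq f g : (forall q, U q -> f q = g q) -> v f = v g.
Proof.
have [_ _ v3 _] := tv => fg; apply: v3.
by apply: filterS (open_nbhs_nbhs (conj oU Up)) => q /fg.
Qed.

Lemma tangentD f g : smooth_on U f -> smooth_on U g ->
  v (fun q => f q + g q) = v f + v g.
Proof.
have [v1 _ _ _] := tv => sf sg.
have := v1 1 f g (smooth_onW oU Up sf) (smooth_onW oU Up sg).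
by under eq_fun do rewrite mul1r; rewrite mul1r.
Qed.

Lemma tangentM f g : smooth_on U f -> smooth_on U g ->
  v (fun q => f q * g q) = v f * g p + f p * v g.
Proof.
have [_ v2 _ _] := tv => sf sg.
exact: v2 (smooth_onW oU Up sf) (smooth_onW oU Up sg).
Qed.

Lemma tangentZ (r : R) f : smooth_on U f -> v (fun q => r * f q) = r * v f.
Proof.
move=> sf; rewrite tangentM //; last exact: smooth_on_cst.
by rewrite tangent_cst mul0r add0r.
Qed.

Lemma tangentB f g : smooth_on U f -> smooth_on U g ->
  v (fun q => f q - g q) = v f - v g.
Proof.
move=> sf sg; rewrite tangentD //; last exact: smooth_onN.
by under eq_fun do rewrite -mulN1r; rewrite tangentZ // mulN1r.
Qed.

Lemma tangent_sum (I : Type) (r : seq I) (F : I -> M -> R) :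
  (forall i, smooth_on U (F i)) ->
  v (fun q => \sum_(i <- r) F i q) = \sum_(i <- r) v (F i).
Proof.
move=> sF; elim: r => [|i r IH].
  by under eq_fun do rewrite big_nil; rewrite big_nil tangent_cst.
under eq_fun do rewrite big_cons.
by rewrite tangentD // ?IH ?big_cons //; exact: smooth_on_sum.
Qed.

End Derivation.

Lemma smooth_vf0 U : smooth_vf U (fun _ _ => 0).
Proof. by split=> *; [exact: is_tangent0|exact: smooth_on_cst]. Qed.

Lemma smooth_vf_sum (I : Type) (r : seq I) U (c : I -> M -> R)
    (X : I -> vector_field M) : open U -> (forall i, smooth_on U (c i)) ->
  (forall i, smooth_vf U (X i)) ->
  smooth_vf U (fun q f => \sum_(i <- r) c i q * X i q f).
Proof.
move=> oU sc sX; split=> [p Up|V f oV VU sf].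
  by apply: is_tangent_sum => i; have [+ _] := sX i; exact.
apply: smooth_on_sum => // i; apply: smooth_onM => //.
  exact: smooth_on_sub (sc i).
by have [_ +] := sX i; exact.
Qed.

Lemma smooth_vfZ U (c : M -> R) (X : vector_field M) : open U ->
  smooth_on U c -> smooth_vf U X -> smooth_vf U (fun q f => c q * X q f).
Proof.
move=> oU sc sX; split=> [p Up|V f oV VU sf].
  have [+ _] := sX => /(_ p Up) tX.
  have := is_tangent_lin (c p) tX (is_tangent0 p).
  by under eq_fun do rewrite addr0.
apply: smooth_onM => //; first exact: smooth_on_sub sc.
by have [_ +] := sX; exact.
Qed.

End Tangent.

(** * Divergence and Laplacian in a local orthonormal frame *)

Section Frame.
Context {R : realType} {d : nat} {M : smooth_manifold R d}
  {h : riemannian_metric M}.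
Implicit Types (U V : set M) (f g : M -> R) (u v w : functional M).

Lemma metric_suml (I : Type) (r : seq I) (p : M) (c : I -> R)
    (v : I -> functional M) w : (forall i, is_tangent p (v i)) ->
  is_tangent p w ->
  h p (fun f => \sum_(i <- r) c i * v i f) w = \sum_(i <- r) c i * h p (v i) w.
Proof.
move=> tv tw; elim: r => [|i r IH].
  rewrite big_nil; under eq_fun do rewrite big_nil.
  have t0 := is_tangent0 p.
  have := metric_linear h 1 t0 t0 tw; under eq_fun do rewrite mulr0 addr0.
  by rewrite mul1r -[X in X = _]addr0 => /addrI.
under eq_fun do rewrite big_cons.
by rewrite metric_linear // ?IH ?big_cons //; exact: is_tangent_sum.
Qed.

Variables (U : set M) (e : 'I_d -> vector_field M).
Hypotheses (oU : open U) (oe : orthonormal_frame h U e).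

Lemma frame_smooth al : smooth_vf U (e al).
Proof. by have [+ _ _] := oe; exact. Qed.

Lemma frame_tangent al p : U p -> is_tangent p (e al p).
Proof. by have [+ _] := frame_smooth al; exact. Qed.

Lemma frame_smooth_on al f : smooth_on U f -> smooth_on U (fun q => e al q f).
Proof. by have [_ +] := frame_smooth al; exact. Qed.

(** The frame spans the tangent space by assumption; pairing a combination with [e al p] identifies
    its coefficients by orthonormality. *)
Lemma frame_expansion p v : U p -> is_tangent p v ->
  v = (fun f => \sum_al h p v (e al p) * e al p f).
Proof.
move=> Up tv; have [_ ho /(_ p v Up tv)[c vE]] := oe.
apply/funext => f; rewrite [in LHS]vE; apply: eq_bigr => al _; congr (_ * _).
have te be := frame_tangent be Up.
rewrite vE metric_suml //; rewrite (bigD1 al) //= ho // eqxx mulr1.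
by rewrite big1 ?addr0 // => be ne; rewrite ho // (negbTE ne) mulr0.
Qed.

Context {D : levi_civita h}.

Lemma nabla_sum (I : Type) (r : seq I) (p : M) v (c : I -> M -> R)
    (Y : I -> vector_field M) : U p -> is_tangent p v ->
  (forall i, smooth_on U (c i)) -> (forall i, smooth_vf U (Y i)) ->
  D p v (fun q f => \sum_(i <- r) c i q * Y i q f) =
  (fun f => \sum_(i <- r) (v (c i) * Y i p f + c i p * D p v (Y i) f)).
Proof.
move=> Up tv sc sY; elim: r => [|i r IH].
  (* Empty sum: additivity applied to 0 + 0 = 0 shows that the zero field has zero covariant
     derivative. *)
  have sv0 := smooth_vf0 U.
  have N := nabla_add D oU Up sv0 sv0 tv.
  have zz : (fun (q : M) (f : M -> R) => 0 + 0) = (fun _ _ => 0 : R).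
    by apply/funext => q; apply/funext => f; rewrite addr0.
  rewrite zz in N.
  have -> : (fun q f => \sum_(i <- [::]) c i q * Y i q f) = (fun _ _ => 0).
    by apply/funext => q; apply/funext => f; rewrite big_nil.
  apply/funext => f; have := congr1 (fun F : functional M => F f) N.
  by rewrite big_nil -[X in X = _]addr0 => /addrI.
have -> : (fun q f => \sum_(i <- i :: r) c i q * Y i q f) =
    (fun q f => c i q * Y i q f + \sum_(i <- r) c i q * Y i q f).
  by apply/funext => q; apply/funext => f; rewrite big_cons.
rewrite (nabla_add D oU Up (smooth_vfZ oU (sc i) (sY i)) _ tv); last first.
  exact: smooth_vf_sum.
rewrite IH (nabla_leibniz D oU Up) //.
by apply/funext => f; rewrite big_cons.
Qed.

(** Metric compatibility, applied to the pairing of two frame fields, which is constant on [U]. *)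
Lemma frame_nabla_anti p v be ga : U p -> is_tangent p v ->
  h p (D p v (e be)) (e ga p) = - h p (D p v (e ga)) (e be p).
Proof.
move=> Up tv; have [_ ho _] := oe.
have te al := frame_tangent al Up.
have := nabla_metric D oU Up (frame_smooth be) (frame_smooth ga) tv.
rewrite (tangent_eq oU Up tv (g := fun=> (be == ga)%:R)); last first.
  by move=> q Uq; exact: ho.
rewrite (tangent_cst oU Up tv) (Defs.metric_sym h (p := p) (u := e be p)) //.
  by move/esym/eqP; rewrite addr_eq0 => /eqP.
exact: nabla_tangent oU Up (frame_smooth ga) tv.
Qed.

(** The Leibniz rule for the connection differentiates either the coefficients or the frame fields;
    in the first case, pairing with [e al p] keeps only the coefficient with index [al]. *)
Lemma divergence_frame (c : 'I_d -> M -> R) (X : vector_field M) p : U p ->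
  (forall al, smooth_on U (c al)) -> smooth_vf U X ->
  (forall q, U q -> X q = (fun f => \sum_al c al q * e al q f)) ->
  divergence D e X p = \sum_al e al p (c al) +
    \sum_al \sum_be c be p * h p (D p (e al p) (e be)) (e al p).
Proof.
move=> Up sc sX XE; have [_ ho _] := oe.
have te al := frame_tangent al Up.
have tD al be : is_tangent p (D p (e al p) (e be)).
  exact: nabla_tangent oU Up (frame_smooth be) (te al).
rewrite /divergence -big_split; apply: eq_bigr => al _ /=.
(* [X] may be a global field that agrees with its frame expansion only on [U]; the connection being
   local, the expansion can replace it. *)
rewrite (nabla_local D oU Up sX _ (te al) XE); last first.
  by apply: smooth_vf_sum => // be; exact: frame_smooth.
rewrite nabla_sum //; last by move=> be; exact: frame_smooth.
under eq_fun do rewrite big_split /=.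
have -> : (fun f => \sum_be e al p (c be) * e be p f +
    \sum_be c be p * D p (e al p) (e be) f) =
    (fun f => 1 * (\sum_be e al p (c be) * e be p f) +
    \sum_be c be p * D p (e al p) (e be) f).
  by apply/funext => f; rewrite mul1r.
rewrite metric_linear //; [|exact: is_tangent_sum..].
rewrite mul1r !metric_suml //; congr (_ + _).
rewrite (bigD1 al) //= ho // eqxx mulr1 big1 ?addr0 // => be ne.
by rewrite ho // (negbTE ne) mulr0.
Qed.

Lemma gradient_smooth f : smooth_on U f -> smooth_vf U (gradient e f).
Proof.
move=> sf; apply: smooth_vf_sum => // al; last exact: frame_smooth.
exact: frame_smooth_on.
Qed.

Lemma laplacian_frame f p : U p -> smooth_on U f ->
  laplacian D e f p = \sum_al e al p (fun q => e al q f) +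
    \sum_al \sum_be e be p f * h p (D p (e al p) (e be)) (e al p).
Proof.
move=> Up sf; rewrite /laplacian (divergence_frame (c := fun al q => e al q f)) //.
  by move=> al; exact: frame_smooth_on.
exact: gradient_smooth.
Qed.

End Frame.

(** * Complex parts, adjoint matrices and the hermitian product *)

Section Hermitian.
Context {R : realType}.
Local Open Scope complex_scope.

Lemma ReC0 : complex.Re (0 : R[i]) = 0.
Proof. by []. Qed.

Lemma ReCD (x y : R[i]) : complex.Re (x + y) = complex.Re x + complex.Re y.
Proof. by case: x y => [? ?] [? ?]. Qed.

Lemma ReCN (x : R[i]) : complex.Re (- x) = - complex.Re x.
Proof. by case: x. Qed.

Lemma ReCB (x y : R[i]) : complex.Re (x - y) = complex.Re x - complex.Re y.
Proof. by rewrite ReCD ReCN. Qed.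

Lemma ReCM (x y : R[i]) : complex.Re (x * y) =
  complex.Re x * complex.Re y - complex.Im x * complex.Im y.
Proof. by case: x y => [? ?] [? ?]. Qed.

Lemma ImCM (x y : R[i]) : complex.Im (x * y) =
  complex.Re x * complex.Im y + complex.Im x * complex.Re y.
Proof. by case: x y => [? ?] [? ?]. Qed.

Lemma ReCZ (r : R) (x : R[i]) : complex.Re (r%:C * x) = r * complex.Re x.
Proof. by rewrite ReCM /= mul0r subr0. Qed.

Lemma ReC_conj (x : R[i]) : complex.Re (conjc x) = complex.Re x.
Proof. by case: x. Qed.

Lemma Re_sum (I : Type) (r : seq I) (F : I -> R[i]) :
  complex.Re (\sum_(i <- r) F i) = \sum_(i <- r) complex.Re (F i).
Proof. exact: (big_morph _ ReCD ReC0). Qed.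

Lemma Im_sum (I : Type) (r : seq I) (F : I -> R[i]) :
  complex.Im (\sum_(i <- r) F i) = \sum_(i <- r) complex.Im (F i).
Proof. by apply: (big_morph _ _ _) => // [] [? ?] [? ?]. Qed.

Lemma adjmxM m n p (A : 'M[R[i]]_(m, n)) (B : 'M[R[i]]_(n, p)) :
  adjmx (A *m B) = adjmx B *m adjmx A.
Proof. by rewrite /adjmx map_mxM trmx_mul. Qed.

Lemma adjmxD m n (A B : 'M[R[i]]_(m, n)) : adjmx (A + B) = adjmx A + adjmx B.
Proof. by apply/matrixP => i j; rewrite !mxE rmorphD. Qed.

Lemma adjmx0 m n : adjmx (0 : 'M[R[i]]_(m, n)) = 0.
Proof. by apply/matrixP => i j; rewrite !mxE rmorph0. Qed.

Lemma adjmx1 n : adjmx (1%:M : 'M[R[i]]_n) = 1%:M.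
Proof. by apply/matrixP => i j; rewrite !mxE eq_sym rmorph_nat. Qed.

Lemma adjmxZ m n (c : R) (A : 'M[R[i]]_(m, n)) :
  adjmx (c%:C *: A) = c%:C *: adjmx A.
Proof.
by apply/matrixP => i j; rewrite !mxE rmorphM; congr (_ * _); exact: conjc_real.
Qed.

Lemma adjmx_sum m n (I : Type) (r : seq I) (F : I -> 'M[R[i]]_(m, n)) :
  adjmx (\sum_(i <- r) F i) = \sum_(i <- r) adjmx (F i).
Proof. exact: (big_morph _ (@adjmxD m n) (@adjmx0 m n)). Qed.

Section Herm.
Variable N : nat.
Implicit Types (u v w : 'cV[R[i]]_N) (A : 'M[R[i]]_N).

(** Turns linearity in the second slot and passage to the adjoint into matrix algebra. *)
Lemma hermE u v : herm u v = (adjmx u *m v) 0 0.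
Proof. by rewrite /herm mxE; apply: eq_bigr => k _; rewrite !mxE. Qed.

Lemma herm_conj u v : conjc (herm u v) = herm v u.
Proof.
rewrite /herm rmorph_sum; apply: eq_bigr => k _.
by rewrite rmorphM /= conjcK mulrC.
Qed.

Lemma hermDr u v w : herm u (v + w) = herm u v + herm u w.
Proof. by rewrite !hermE mulmxDr mxE. Qed.

Lemma herm0r u : herm u 0 = 0.
Proof. by rewrite hermE mulmx0 mxE. Qed.

Lemma hermZr u c v : herm u (c *: v) = c * herm u v.
Proof. by rewrite !hermE -scalemxAr mxE. Qed.

Lemma hermNr u v : herm u (- v) = - herm u v.
Proof. by rewrite !hermE mulmxN mxE. Qed.

Lemma herm_sumr u (I : Type) (r : seq I) (F : I -> 'cV[R[i]]_N) :
  herm u (\sum_(i <- r) F i) = \sum_(i <- r) herm u (F i).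
Proof. exact: (big_morph _ (hermDr u) (herm0r u)). Qed.

Lemma Re_herm_sumr u (I : Type) (r : seq I) (F : I -> 'cV[R[i]]_N) :
  complex.Re (herm u (\sum_(i <- r) F i)) =
  \sum_(i <- r) complex.Re (herm u (F i)).
Proof. by rewrite herm_sumr Re_sum. Qed.

Lemma herm_mulmxl A u v : herm (A *m u) v = herm u (adjmx A *m v).
Proof. by rewrite !hermE adjmxM mulmxA. Qed.

Lemma Re_hermC u v : complex.Re (herm u v) = complex.Re (herm v u).
Proof. by rewrite -herm_conj ReC_conj. Qed.

(** The euclidean product of R^(2N). Smoothness and derivations are defined for real functions only,
    and reach spinors through this formula. *)
Lemma Re_hermE u v : complex.Re (herm u v) =
  \sum_k (complex.Re (u k 0) * complex.Re (v k 0) +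
          complex.Im (u k 0) * complex.Im (v k 0)).
Proof.
rewrite Re_sum; apply: eq_bigr => k _; rewrite ReCM.
by case: (u k 0) => [? ?] /=; rewrite mulNr opprK.
Qed.

End Herm.
End Hermitian.

(** * Clifford algebra: unitarity of Spin(d) and the symmetry defect of the Dirac operator *)

Section Clifford.
Context {R : realType} {d : nat} (g : clifford_rep R d).
Local Open Scope complex_scope.

Lemma gamma_vec_adj (x : 'rV[R]_d) : adjmx (gamma_vec g x) = - gamma_vec g x.
Proof.
rewrite /gamma_vec adjmx_sum -sumrN; apply: eq_bigr => al _.
by rewrite adjmxZ gamma_skew scalerN.
Qed.

(** Twice the square, with the indices exchanged in one copy, is a sum of anticommutators, of which
    the Clifford relations leave only the diagonal. *)
Lemma gamma_vec_sqr (x : 'rV[R]_d) :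
  gamma_vec g x *m gamma_vec g x = - (\sum_al x 0 al ^+ 2)%:C%:M.
Proof.
apply: (scalerI (a := 2)); first by rewrite pnatr_eq0.
have E : gamma_vec g x *m gamma_vec g x =
    \sum_al \sum_be (x 0 al * x 0 be)%:C *: (g al *m g be).
  rewrite mulmx_suml; apply: eq_bigr => al _; rewrite mulmx_sumr.
  by apply: eq_bigr => be _; rewrite -scalemxAl -scalemxAr scalerA rmorphM.
rewrite scaler_nat mulr2n {1}E {}E [X in X + _]exchange_big -big_split /=.
rewrite rmorph_sum raddf_sum -sumrN scaler_sumr; apply: eq_bigr => al _.
rewrite -big_split /= (bigD1 al) //= big1 => [|be ne].
  rewrite addr0 -scalerDr gamma_clifford eqxx mulr1 scale_scalar_mx.
  by rewrite mulrN raddfN scalerN scale_scalar_mx rmorphXn /= mulrC.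
rewrite (mulrC (x 0 be)) -scalerDr gamma_clifford (negbTE ne) mulr0 oppr0.
by rewrite raddf0 scaler0.
Qed.

(** A unit vector is skew-adjoint with square -1, hence unitary; in [adjmx T *m T] the factors
    cancel from the inside, one vector at a time. *)
Lemma spin_group_unitary (T : 'M[R[i]]_(spin_dim d)) :
  spin_group g T -> adjmx T *m T = 1%:M.
Proof.
move=> [s [_ s1 ->]]; elim: s s1 => [|x s IH] s1 /=.
  by rewrite adjmx1 mul1mx.
rewrite adjmxM gamma_vec_adj mulmxA -(mulmxA _ (- _)) mulNmx gamma_vec_sqr.
rewrite opprK s1 ?mem_head // mulmx1 IH // => y ys.
by apply: s1; rewrite inE ys orbT.
Qed.

(** The adjoint reverses a triple product and changes its sign; antisymmetry of [G] absorbs the sign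
    when the last two indices are swapped. So [A - adjmx A] is a sum of commutators of [g al] with
    [g be *m g ga], which have degree one. *)
Lemma gamma_antisym (G : 'I_d -> 'I_d -> 'I_d -> R) :
  (forall al be ga, G al be ga = - G al ga be) ->
  let A := 4^-1 *: \sum_al \sum_be \sum_ga
    (G al be ga)%:C *: (g al *m (g be *m g ga)) in
  A - adjmx A = \sum_al \sum_be (G al be al)%:C *: g be.
Proof.
move=> aG A.
have r4 : (4^-1 : R[i]) = (4^-1 : R)%:C by rewrite fmorphV rmorph_nat.
have adjg al be ga : adjmx (g al *m (g be *m g ga)) =
    - (g ga *m (g be *m g al)).
  by rewrite !adjmxM !gamma_skew !mulmxN !mulNmx !opprK mulmxA.
have -> : adjmx A = 4^-1 *: \sum_al \sum_be \sum_ga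
    (G al be ga)%:C *: (g be *m (g ga *m g al)).
  rewrite /A r4 adjmxZ adjmx_sum; congr (_ *: _); apply: eq_bigr => al _.
  rewrite adjmx_sum [RHS]exchange_big /=; apply: eq_bigr => be _.
  rewrite adjmx_sum; apply: eq_bigr => ga _.
  by rewrite adjmxZ adjg (aG al be ga) rmorphN /= scaleNr scalerN opprK.
have comm al be ga : g al *m (g be *m g ga) - g be *m (g ga *m g al) =
    (2 * (al == ga)%:R) *: g be - (2 * (al == be)%:R) *: g ga.
  have E1 : g al *m (g be *m g ga) + g be *m (g al *m g ga) =
      - (2 * (al == be)%:R) *: g ga.
    by rewrite !mulmxA -mulmxDl gamma_clifford mul_scalar_mx.
  have E2 : g be *m (g al *m g ga) + g be *m (g ga *m g al) =
      - (2 * (al == ga)%:R) *: g be.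
    by rewrite -mulmxDr gamma_clifford mul_mx_scalar.
  (* [g al] is carried past [g be] and then past [g ga]; the intermediate product is added and
     subtracted. *)
  rewrite -[LHS](addrKA (g be *m (g al *m g ga))) E1 opprD addrC.
  by rewrite -opprD E2 !scaleNr opprK.
rewrite -scalerBr -sumrB.
have n4 : (4 : R[i]) != 0 by rewrite pnatr_eq0.
apply: (scalerI n4); rewrite scalerA divff // scale1r scaler_sumr.
apply: eq_bigr => al _.
(* Exchanging the names [be] and [ga] in the second term of [comm] gives both terms the same delta
   and matrix. By antisymmetry of [G] they add up to 2 + 2 = 4 times the claim, which [4^-1]
   cancels. *)
transitivity (\sum_be \sum_ga ((G al be ga)%:C *: ((2 * (al == ga)%:R) *: g be) -
    (G al ga be)%:C *: ((2 * (al == ga)%:R) *: g be))).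
  under [RHS]eq_bigr do rewrite sumrB.
  rewrite sumrB [X in _ = _ - X]exchange_big /= -!sumrB.
  apply: eq_bigr => be _; rewrite -!sumrB; apply: eq_bigr => ga _.
  by rewrite -!scalerBr comm.
rewrite scaler_sumr; apply: eq_bigr => be _.
rewrite (bigD1 al) //= big1 => [|ga ne].
  rewrite eqxx mulr1 addr0 (aG al al be) rmorphN /= scaleNr opprK -scalerDl.
  by rewrite !scalerA -mulr2n -[_%:C *+ 2]mulr_natl mulrAC -natrM.
by rewrite eq_sym (negbTE ne) mulr0 scale0r !scaler0 subr0.
Qed.

(** Linear algebra at one point: [du] and [dv] stand for the frame derivatives of two spinors with
    values [u] and [v], and [dir] for the Dirac operator with connection coefficients [G]. *)
Lemma dirac_symmetry_defect (G : 'I_d -> 'I_d -> 'I_d -> R)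
    (u v : 'cV[R[i]]_(spin_dim d)) (du dv : 'I_d -> 'cV[R[i]]_(spin_dim d)) :
  (forall al be ga, G al be ga = - G al ga be) ->
  let dir w dw := \sum_al g al *m (dw al + 4^-1 *: \sum_be \sum_ga
    (G al be ga)%:C *: (g be *m (g ga *m w))) in
  complex.Re (herm (dir u du) v) - complex.Re (herm u (dir v dv)) =
  \sum_al (complex.Re (herm (g al *m du al) v) +
           complex.Re (herm (g al *m u) (dv al))) +
  \sum_al \sum_be complex.Re (herm (g be *m u) v) * G al be al.
Proof.
move=> aG dir; have := gamma_antisym aG => /=.
set A := 4^-1 *: _ => AE.
have dirE w dw : dir w dw = \sum_al g al *m dw al + A *m w.
  rewrite /dir; under eq_bigr do rewrite mulmxDr.
  rewrite big_split /=; congr (_ + _).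
  rewrite /A -scalemxAl mulmx_suml scaler_sumr; apply: eq_bigr => al _.
  rewrite -scalemxAr mulmx_suml mulmx_sumr; congr (_ *: _).
  apply: eq_bigr => be _; rewrite mulmx_suml mulmx_sumr.
  by apply: eq_bigr => ga _; rewrite -scalemxAl -scalemxAr !mulmxA.
rewrite !dirE (Re_hermC (_ + _) v) !hermDr !ReCD !Re_herm_sumr.
rewrite (Re_hermC v (A *m u)).
rewrite [X in _ = X + _]big_split /= opprD addrACA; congr (_ + _ + _).
- by apply: eq_bigr => al _; rewrite Re_hermC.
- rewrite -sumrN; apply: eq_bigr => al _.
  by rewrite herm_mulmxl gamma_skew mulNmx hermNr ReCN.
(* The zeroth-order terms combine to minus the pairing of [u] with [(A - adjmx A) *m v]; skewness of
   [g be] turns the sign around. *)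
rewrite herm_mulmxl -ReCB -hermNr -hermDr -mulNmx -mulmxDl.
rewrite -opprB AE mulNmx hermNr ReCN mulmx_suml Re_herm_sumr -sumrN.
apply: eq_bigr => al _; rewrite mulmx_suml Re_herm_sumr -sumrN.
apply: eq_bigr => be _; rewrite -scalemxAl hermZr ReCZ herm_mulmxl gamma_skew.
by rewrite mulNmx hermNr ReCN mulNr mulrC.
Qed.

End Clifford.

(** * Smoothness and derivatives of spinor-valued functions *)

Section SpinorCalculus.
Context {R : realType} {d : nat} {M : smooth_manifold R d} {N : nat}.
Variables (U : set M) (F G : M -> 'cV[R[i]]_N) (A : 'M[R[i]]_N).
Hypotheses (oU : open U) (sF : forall k, smooth_onC U (fun q => F q k 0))
  (sG : forall k, smooth_onC U (fun q => G q k 0)).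

(** The matrix [A] is constant because Clifford multiplication by a frame vector is the fixed matrix
    [g al] in a spin trivialization. *)
Lemma smooth_onC_mulmx k : smooth_onC U (fun q => (A *m F q) k 0).
Proof.
split.
  apply: (smooth_on_eq oU (f := fun q => \sum_l
      (complex.Re (A k l) * complex.Re (F q l 0) -
       complex.Im (A k l) * complex.Im (F q l 0)))) => [q Uq|].
    by rewrite mxE Re_sum; apply: eq_bigr => l _; rewrite ReCM.
  apply: smooth_on_sum => // l; have [sr si] := sF l.
  by apply: smooth_onB => //; apply: smooth_onM => //; exact: smooth_on_cst.
apply: (smooth_on_eq oU (f := fun q => \sum_l
    (complex.Re (A k l) * complex.Im (F q l 0) +
     complex.Im (A k l) * complex.Re (F q l 0)))) => [q Uq|].
  by rewrite mxE Im_sum; apply: eq_bigr => l _; rewrite ImCM.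
apply: smooth_on_sum => // l; have [sr si] := sF l.
by apply: smooth_onD => //; apply: smooth_onM => //; exact: smooth_on_cst.
Qed.

Lemma smooth_on_Re_herm : smooth_on U (fun q => complex.Re (herm (F q) (G q))).
Proof.
apply: (smooth_on_eq oU (f := fun q => \sum_k
    (complex.Re (F q k 0) * complex.Re (G q k 0) +
     complex.Im (F q k 0) * complex.Im (G q k 0)))) => [q Uq|].
  by rewrite Re_hermE.
apply: smooth_on_sum => // k.
have [sFr sFi] := sF k; have [sGr sGi] := sG k.
by apply: smooth_onD => //; exact: smooth_onM.
Qed.

Variables (p : M) (v : functional M).
Hypotheses (Up : U p) (tv : is_tangent p v).

Lemma tangent_Re_herm : v (fun q => complex.Re (herm (F q) (G q))) =
  complex.Re (herm (dirderC v F) (G p)) + complex.Re (herm (F p) (dirderC v G)).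
Proof.
under eq_fun do rewrite Re_hermE.
rewrite (tangent_sum oU Up tv) => [|k]; last first.
  have [sFr sFi] := sF k; have [sGr sGi] := sG k.
  by apply: smooth_onD => //; exact: smooth_onM.
rewrite !Re_hermE -big_split; apply: eq_bigr => k _ /=.
have [sFr sFi] := sF k; have [sGr sGi] := sG k.
rewrite (tangentD oU Up tv); [|exact: smooth_onM..].
by rewrite !(tangentM oU Up tv) // !mxE /= addrACA.
Qed.

(** The real and imaginary parts of the entries of [A] are constants, which the derivation lets
    through. *)
Lemma dirderC_mulmx : dirderC v (fun q => A *m F q) = A *m dirderC v F.
Proof.
apply/matrixP => k j; rewrite ord1 {j} !mxE.
have ZR l : v (fun q => complex.Re (A k l * F q l 0)) =
    complex.Re (A k l) * v (fun q => complex.Re (F q l 0)) -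
    complex.Im (A k l) * v (fun q => complex.Im (F q l 0)).
  have [sr si] := sF l; under eq_fun do rewrite ReCM.
  rewrite (tangentB oU Up tv) ?(tangentZ oU Up tv) //.
    by apply: smooth_onM => //; exact: smooth_on_cst.
  by apply: smooth_onM => //; exact: smooth_on_cst.
have ZI l : v (fun q => complex.Im (A k l * F q l 0)) =
    complex.Re (A k l) * v (fun q => complex.Im (F q l 0)) +
    complex.Im (A k l) * v (fun q => complex.Re (F q l 0)).
  have [sr si] := sF l; under eq_fun do rewrite ImCM.
  rewrite (tangentD oU Up tv) ?(tangentZ oU Up tv) //.
    by apply: smooth_onM => //; exact: smooth_on_cst.
  by apply: smooth_onM => //; exact: smooth_on_cst.
have sR l : smooth_on U (fun q => complex.Re (A k l * F q l 0)).
  have [sr si] := sF l; apply: (smooth_on_eq oU (f := fun q =>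
    complex.Re (A k l) * complex.Re (F q l 0) -
    complex.Im (A k l) * complex.Im (F q l 0))) => [q _|]; first by rewrite ReCM.
  by apply: smooth_onB => //; apply: smooth_onM => //; exact: smooth_on_cst.
have sI l : smooth_on U (fun q => complex.Im (A k l * F q l 0)).
  have [sr si] := sF l; apply: (smooth_on_eq oU (f := fun q =>
    complex.Re (A k l) * complex.Im (F q l 0) +
    complex.Im (A k l) * complex.Re (F q l 0))) => [q _|]; first by rewrite ImCM.
  by apply: smooth_onD => //; apply: smooth_onM => //; exact: smooth_on_cst.
under eq_fun do rewrite mxE Re_sum.
under [X in (_ +i* v X)%C]eq_fun do rewrite mxE Im_sum.
rewrite !(tangent_sum oU Up tv) //.
apply/eqP; rewrite eq_complex /= Re_sum Im_sum; apply/andP; split; apply/eqP.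
  by apply: eq_bigr => l _; rewrite ZR mxE ReCM.
by apply: eq_bigr => l _; rewrite ZI mxE ImCM.
Qed.

End SpinorCalculus.

(** * The current as a global vector field, its divergence, and the field equations *)

Section Current.
Context {R : realType} {d n : nat} {M : smooth_manifold R d}
  {h : riemannian_metric M} (D : levi_civita h) {g : clifford_rep R d}
  {S : spin_structure h g}.
Variables (kappa : R) (phi : 'I_n.+1 -> M -> R) (psi : 'I_n.+1 -> spinor_field S).
Hypothesis sphi : forall i, smooth_on setT (phi i).
Implicit Types (a b : spin_index S) (p : M) (i m j : 'I_n.+1).

Let sphia a i : smooth_on (spin_dom a) (phi i).
Proof. exact: smooth_on_sub (sphi i). Qed.

Let oa a : open (spin_dom a).
Proof. exact: spin_dom_open. Qed.

Lemma current_smooth i m a al :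
  smooth_on (spin_dom a) (fun q => current_comp phi psi i m a q al).
Proof.
have oe := spin_frame_orthonormal a.
apply: smooth_onD => //.
  apply: smooth_on_Re_herm => // k; last exact: spinor_smooth.
  by apply: smooth_onC_mulmx => // l; exact: spinor_smooth.
by apply: smooth_onB => //; apply: smooth_onM => //;
  exact: (frame_smooth_on (oa a) oe al (sphia a _)).
Qed.

(** The transformation law of vector components: for the spinor term it comes from the spin lift,
    for the map term from expanding one frame in the other. *)
Lemma current_change i m a b p be : spin_dom a p -> spin_dom b p ->
  current_comp phi psi i m b p be =
  \sum_al h p (spin_frame b be p) (spin_frame a al p) *
          current_comp phi psi i m a p al.
Proof.
move=> ap bp.
have tb : is_tangent p (spin_frame b be p).
  exact: (frame_tangent (spin_frame_orthonormal b) be bp).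
have eE := frame_expansion (spin_frame_orthonormal a) ap tb.
rewrite /current_comp /dphi.
under [RHS]eq_bigr do rewrite mulrDr.
rewrite [RHS]big_split /=; congr (_ + _).
  have T1 := spin_group_unitary (spin_trans_spin ap bp).
  (* Unitarity of the transition matrix, which maps [psi m b p] to [psi m a p]. After this,
     [spin_lift] carries it past [g be] onto [psi i b p]. *)
  have -> : herm (g be *m psi i b p) (psi m b p) =
      herm (spin_trans a b p *m (g be *m psi i b p)) (psi m a p).
    by rewrite (herm_mulmxl (spin_trans a b p)) (spinor_glue (psi m) ap bp) mulmxA T1 mul1mx.
  rewrite mulmxA spin_lift // -mulmxA -(spinor_glue (psi i) ap bp).
  rewrite mulmx_suml Re_hermC Re_herm_sumr; apply: eq_bigr => al _.
  by rewrite -scalemxAl hermZr ReCZ Re_hermC.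
(* Only the two frame vectors that differentiate on the left are expanded; those inside the metric
   stay. *)
rewrite {1 2}eE mulr_suml mulr_sumr -sumrB; apply: eq_bigr => al _.
by ring.
Qed.

Lemma current_frame_indep i m a b p : spin_dom a p -> spin_dom b p ->
  (fun f => \sum_al current_comp phi psi i m a p al * spin_frame a al p f) =
  (fun f => \sum_al current_comp phi psi i m b p al * spin_frame b al p f).
Proof.
move=> ap bp; apply/funext => f.
have ta al : is_tangent p (spin_frame a al p).
  exact: (frame_tangent (spin_frame_orthonormal a) al ap).
have tb be : is_tangent p (spin_frame b be p).
  exact: (frame_tangent (spin_frame_orthonormal b) be bp).
under eq_bigr => al _ do
  rewrite (frame_expansion (spin_frame_orthonormal b) bp (ta al)) mulr_sumr.
rewrite exchange_big /=; apply: eq_bigr => be _.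
rewrite (current_change i m be ap bp) mulr_suml; apply: eq_bigr => al _.
by rewrite (Defs.metric_sym h (ta al) (tb be)) mulrA (mulrC (current_comp _ _ _ _ _ _ _)).
Qed.

(** The trivialization is picked by choice, separately at each point; [current_frame_indep] makes
    the value independent of it. *)
Definition current i m : vector_field M := fun p f =>
  let a := projT1 (cid (spin_cover S p)) in
  \sum_al current_comp phi psi i m a p al * spin_frame a al p f.

Lemma currentE i m a p : spin_dom a p -> current i m p =
  (fun f => \sum_al current_comp phi psi i m a p al * spin_frame a al p f).
Proof.
move=> ap; rewrite /current; case: cid => b /= bp.
exact: current_frame_indep.
Qed.

(** Smoothness is local, and on each [spin_dom a] the field equals one fixed smooth combination of
    frame fields. *)
Lemma smooth_current i m : smooth_vf setT (current i m).
Proof.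
have sl a : smooth_vf (spin_dom a) (fun q f =>
    \sum_al current_comp phi psi i m a q al * spin_frame a al q f).
  apply: smooth_vf_sum => // al; first exact: current_smooth.
  exact: (frame_smooth (spin_frame_orthonormal a) al).
split=> [p _|V f oV _ sf].
  have [a ap] := spin_cover S p; rewrite (currentE i m ap).
  by have [+ _] := sl a; exact.
apply: smooth_on_local => p Vp; have [a ap] := spin_cover S p.
exists (V `&` spin_dom a); first by [].
have oW : open (V `&` spin_dom a) by exact: openI.
have [_ sla] := sl a.
apply: smooth_on_eq oW _ (sla _ _ oW (@subIsetr _ _ _) (smooth_on_sub _ sf)).
  by move=> q [Vq aq]; rewrite (currentE i m aq).
exact: subIsetl.
Qed.

(** A Green-type identity, prior to the field equations: the divergence measures the failure of
    symmetry of the Dirac operator and of the Laplacian. *)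
Lemma divergence_current i m a p : spin_dom a p ->
  divergence D (spin_frame a) (current i m) p =
  (complex.Re (herm (Defs.dirac D (psi i) a p) (psi m a p)) -
   complex.Re (herm (psi i a p) (Defs.dirac D (psi m) a p))) +
  (laplacian D (spin_frame a) (phi i) p * phi m p -
   phi i p * laplacian D (spin_frame a) (phi m) p).
Proof.
move=> ap; have oe := spin_frame_orthonormal a.
have te al := frame_tangent oe al ap.
rewrite (divergence_frame (oa a) oe
  (c := fun al q => current_comp phi psi i m a q al)) //; first last.
- by move=> q aq; exact: currentE.
- have [tJ sJ] := smooth_current i m; split=> [q _|V f oV _ sf]; first exact: tJ.
  exact: sJ.
- by move=> al; exact: current_smooth.
set G := fun al be ga => h p (D p (spin_frame a al p) (spin_frame a be))
   (spin_frame a ga p).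
have aG al be ga : G al be ga = - G al ga be.
  exact: (frame_nabla_anti (oa a) oe be ga ap (te al)).
have := dirac_symmetry_defect g (psi i a p) (psi m a p)
  (fun al => dirderC (spin_frame a al p) (psi i a))
  (fun al => dirderC (spin_frame a al p) (psi m a)) aG.
rewrite /Defs.dirac /spin_connection => -> /=.
rewrite !(laplacian_frame (oa a) oe) //.
rewrite mulrDl mulrDr opprD [X in _ = _ + X]addrACA [RHS]addrACA.
(* First the derivatives of the components, then the terms with connection coefficients. *)
congr (_ + _).
  rewrite mulr_suml mulr_sumr -sumrB -big_split; apply: eq_bigr => al _ /=.
  have sd j : smooth_on (spin_dom a) (fun q => dphi phi a q j al).
    exact: (frame_smooth_on (oa a) oe al (sphia a j)).
  have sg k : smooth_onC (spin_dom a) (fun q => (g al *m psi i a q) k 0).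
    by apply: smooth_onC_mulmx => // l; exact: spinor_smooth.
  have sm k : smooth_onC (spin_dom a) (fun q => psi m a q k 0).
    exact: spinor_smooth.
  rewrite /current_comp (tangentD (oa a) ap (te al)); last 2 first.
  - exact: smooth_on_Re_herm.
  - by apply: smooth_onB => //; exact: smooth_onM.
  rewrite (tangent_Re_herm (oa a) sg sm ap (te al)).
  rewrite (dirderC_mulmx _ (oa a) _ ap (te al)); last first.
    by move=> k; exact: spinor_smooth.
  congr (_ + _); rewrite (tangentB (oa a) ap (te al)); [|exact: smooth_onM..].
  (* The products of first derivatives of [phi i] and [phi m] cancel. *)
  by rewrite !(tangentM (oa a) ap (te al)) // /dphi; ring.
rewrite mulr_suml mulr_sumr -sumrB -big_split; apply: eq_bigr => al _ /=.
rewrite mulr_suml mulr_sumr -sumrB -big_split; apply: eq_bigr => be _ /=.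
by rewrite /current_comp /dphi /G; ring.
Qed.

(** The spinor equation for [psi m], paired with [psi i]. Its first term is minus [phi m] times the
    spinor term in the equation for [phi i]. *)
Lemma dirac_harmonic_pairing i m a p : dirac_harmonic D kappa phi psi ->
  spin_dom a p ->
  complex.Re (herm (psi i a p) (Defs.dirac D (psi m) a p)) =
  - (phi m p * \sum_al \sum_j
       complex.Re (herm (psi i a p) (g al *m psi j a p)) * dphi phi a p j al)
  - 2 * kappa *
    ((\sum_j sqnorm (psi j a p)) * complex.Re (herm (psi i a p) (psi m a p)) -
     \sum_j complex.Re (herm (psi j a p) (psi m a p) *
                        herm (psi i a p) (psi j a p))).
Proof.
move=> dh ap; rewrite (dh_spinor_eq dh m ap) hermDr !hermNr hermZr.
rewrite ReCB ReCN ReCZ hermDr hermNr hermZr ReCB ReCZ !Re_herm_sumr.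
congr (- _ - _ * (_ - _)).
  rewrite mulr_sumr; apply: eq_bigr => al _.
  rewrite Re_herm_sumr mulr_sumr; apply: eq_bigr => j _.
  by rewrite hermZr ReCZ; ring.
by apply: eq_bigr => j _; rewrite hermZr.
Qed.

End Current.

Theorem lemma3p4 (R : realType) (d n : nat) (M : smooth_manifold R d)
    (M_closed : compact [set: M]) (h : riemannian_metric M)
    (D : levi_civita h) (g : clifford_rep R d) (S : spin_structure h g)
    (kappa : R) (phi : 'I_n.+1 -> M -> R) (psi : 'I_n.+1 -> spinor_field S)
    (dh : dirac_harmonic D kappa phi psi) (i m : 'I_n.+1) :
  exists J : vector_field M,
    [/\ smooth_vf [set: M] J,
        forall (a : spin_index S) (p : M), spin_dom a p ->
          J p = (fun f => \sum_al current_comp phi psi i m a p al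
                                    * spin_frame a al p f) &
        forall (a : spin_index S) (p : M), spin_dom a p ->
          divergence D (spin_frame a) J p = 0].
Proof.
have sphi := dh_smooth dh; exists (current phi psi i m); split.
- exact: smooth_current.
- by move=> a p ap; exact: currentE.
move=> a p ap; rewrite divergence_current //.
have Pim := dirac_harmonic_pairing i m dh ap.
have Pmi := dirac_harmonic_pairing m i dh ap.
(* Exchanging [i] and [m] conjugates each summand, so the real part is unchanged. *)
have quartic_sym : \sum_j complex.Re (herm (psi j a p) (psi i a p) *
    herm (psi m a p) (psi j a p)) = \sum_j complex.Re (herm (psi j a p)
    (psi m a p) * herm (psi i a p) (psi j a p)).
  apply: eq_bigr => j _; rewrite -[LHS]ReC_conj rmorphM mulrC.
  by congr (complex.Re (_ * _)); exact: herm_conj.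
rewrite (Re_hermC (psi m a p) (psi i a p)) quartic_sym in Pmi.
have Pmi' := etrans (Re_hermC (Defs.dirac D (psi i) a p) (psi m a p)) Pmi.
have Li := canRL (@opprK R) (dh_map_eq dh i ap).
have Lm := canRL (@opprK R) (dh_map_eq dh m ap).
(* Rewriting would try to unify the two Dirac operators by unfolding them. *)
apply: etrans (congr2 +%R (congr2 (fun x y => x - y) Pmi' Pim)
  (congr2 (fun x y => x * phi m p - phi i p * y) Li Lm)) _.
(* The [kappa] terms of the two pairings are now equal and cancel, as do the terms with the energy
   density of [phi]; the spinor terms of the map equations cancel the rest of the pairings. *)
by ring.
Qed.
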